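(* Let $D$ be a digraph on $\{1,\dots,n\}$ (as in the context) with associated matrix $B$. If $B^{-1}$ is signable, then $\Gamma_D$ is bipartite.
   Context: Digraphs $D$ are finite, with vertex set $\{1,\dots,n\}$, may have multiple edges but no loops, and every directed edge $i\to j$ satisfies $i<j$. $B=B_D$ is the $n\times n$ upper unitriangular integer matrix with $B_{i,i}=1$ and $B_{i,j}$ equal to the number of edges from $i$ to $j$ for $i\ne j$. $B^{-1}$ is signable if there is a diagonal matrix $S$ with diagonal entries in $\{\pm1\}$ such that $SB^{-1}S=|B^{-1}|$, where $|\cdot|$ is the componentwise absolute value. The maximal-path subgraph $\Gamma_D$ is the spanning subgraph of $D$ containing an edge $e$ of $D$ if and only if there are vertices $i,j$ such that $e$ lies on a directed path from $i$ to $j$ whose length is maximal among all directed paths from $i$ to $j$ in $D$. A digraph is called bipartite if its underlying undirected graph is. *)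

(* Defs.v *)
From HB Require Import structures.
From mathcomp Require Import all_boot all_order all_algebra.

Set Implicit Arguments.
Unset Strict Implicit.
Unset Printing Implicit Defensive.

Import Order.TTheory GRing.Theory Num.Theory.
Local Open Scope ring_scope.

(* The vertices 1, ..., n are represented by the ordinals 0, ..., n - 1.
   Edges form their own type, so that parallel edges are distinct objects;
   [src_lt_tgt] also rules out loops. *)
Record digraph (n : nat) := Digraph {
  edge : finType;
  src : edge -> 'I_n;
  tgt : edge -> 'I_n;
  src_lt_tgt : forall e : edge, (src e < tgt e)%N
}.

Definition dimx n (D : digraph n) : 'M[int]_n :=
  \matrix_(i, j)
    (if i == j then 1
     else (#|[set e : edge D | (src e == i) && (tgt e == j)]|)%:Z).

Lemma dimx_unitmx n (D : digraph n) : dimx D \in unitmx.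
Proof.
rewrite unitmxE -det_tr det_trig; last first.
  apply/is_trig_mxP => i j lt_ij; rewrite !mxE -val_eqE gtn_eqF //=.
  rewrite (_ : [set e | _] = set0) ?cards0 //; apply/setP => e; rewrite !inE.
  apply: contraTF lt_ij => /andP[/eqP <- /eqP <-].
  by rewrite -leqNgt ltnW ?src_lt_tgt.
by rewrite big1 ?unitr1 // => i _; rewrite !mxE eqxx.
Qed.

Definition signable n (A : 'M[int]_n) : Prop :=
  exists S : 'M[int]_n,
    [/\ is_diag_mx S,
        forall i, S i i = 1 \/ S i i = -1
      & S *m A *m S = map_mx (fun x : int => `|x|) A].

(* A path is given by its sequence of edges, so its length is [size p].  The
   vertices along it are strictly increasing, hence distinct.  The empty
   sequence is the path of length 0 from a vertex to itself. *)
Fixpoint dipath n (D : digraph n) (i : 'I_n) (p : seq (edge D)) (j : 'I_n)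
    : bool :=
  if p is e :: p' then (src e == i) && dipath (tgt e) p' j else i == j.

Definition maximal_dipath n (D : digraph n) (i : 'I_n) (p : seq (edge D))
    (j : 'I_n) : Prop :=
  dipath i p j /\
  forall q : seq (edge D), dipath i q j -> (size q <= size p)%N.

(* A spanning subgraph of [D] is represented by its edges, as a predicate on
   [edge D]; its vertex set is all of ['I_n]. *)
Definition maxpath_subgraph n (D : digraph n) (e : edge D) : Prop :=
  exists (i j : 'I_n) (p : seq (edge D)), maximal_dipath i p j /\ e \in p.

Definition underlying_adj n (D : digraph n) (F : edge D -> Prop) (u v : 'I_n)
    : Prop :=
  exists2 e : edge D,
    F e & (src e = u /\ tgt e = v) \/ (src e = v /\ tgt e = u).

Definition bipartite_subgraph n (D : digraph n) (F : edge D -> Prop) : Prop :=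
  exists X : {set 'I_n},
    forall u v : 'I_n, underlying_adj F u v -> (u \in X) != (v \in X).

(* Main.v *)
Require Import Defs.
From mathcomp Require Import all_boot all_order all_algebra.

(** Write [C] for the inverse of [B].  Expanding [B C = 1] along a row gives
    the recursion [C i j = (i == j) - \sum_(k != i) B i k * C k j], whose
    solution counts the paths from [i] to [j], those of even length positively
    and those of odd length negatively.  Two consequences suffice: a
    nonzero entry [C i j] forces a path from [i] to [j] ([invmx_dimx_dipath]),
    and if no path from [u] to [v] is longer than a single edge then
    [C u v = - B u v] ([invmx_dimx_short]).

    An edge [u -> v] of the maximal-path subgraph is itself a longest path from
    [u] to [v], since a longer one could be spliced into the maximal path
    containing the edge ([maxpath_edge_longest]).  Hence [C u v] is minus the
    number of edges from [u] to [v], so it is negative, and a signing matrix [S]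
    must have opposite signs at [u] and [v].  The vertices with sign [1]
    therefore form one side of a bipartition. *)

Set Implicit Arguments.
Unset Strict Implicit.
Unset Printing Implicit Defensive.

Import Order.TTheory GRing.Theory Num.Theory.
Local Open Scope ring_scope.

Lemma dipath_cat n (D : digraph n) (i j k : 'I_n) (p q : seq (edge D)) :
  dipath i p j -> dipath j q k -> dipath i (p ++ q) k.
Proof.
elim: p i => [|e p IHp] i /=; first by move=> /eqP ->.
by move=> /andP[-> /IHp IH] /IH.
Qed.

Lemma dipath_split n (D : digraph n) (i j : 'I_n) (p q : seq (edge D)) e :
  dipath i (p ++ e :: q) j -> dipath i p (src e) /\ dipath (tgt e) q j.
Proof.
elim: p i => [|f p IHp] i /=; first by case/andP=> /eqP -> ->.
by case/andP=> -> /IHp[-> ->].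
Qed.

Lemma dipath_leq n (D : digraph n) (i j : 'I_n) (p : seq (edge D)) :
  dipath i p j -> (i <= j)%N.
Proof.
elim: p i => [|e p IHp] i /=; first by move=> /eqP ->.
case/andP=> /eqP <- /IHp; apply: leq_trans.
exact: ltnW (src_lt_tgt e).
Qed.

Lemma maxpath_edge_longest n (D : digraph n) (e : edge D) (q : seq (edge D)) :
  maxpath_subgraph e -> dipath (src e) q (tgt e) -> (size q <= 1)%N.
Proof.
case=> i [j [p [[pth_p max_p] e_p]]] pth_q.
case/splitPr: e_p pth_p max_p => p1 p2 /dipath_split[pth1 pth2] max_p.
have := max_p _ (dipath_cat pth1 (dipath_cat pth_q pth2)).
by rewrite !size_cat /= leq_add2l -add1n leq_add2r.
Qed.

Lemma dimx_neq0_edge n (D : digraph n) (i j : 'I_n) :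
  i != j -> dimx D i j != 0 -> exists2 e : edge D, src e = i & tgt e = j.
Proof.
move=> /negPf ne_ij; rewrite mxE ne_ij => nz.
have /card_gt0P[e] : (0 < #|[set e : edge D | (src e == i) && (tgt e == j)]|)%N.
  by rewrite lt0n.
by rewrite inE => /andP[/eqP ? /eqP ?]; exists e.
Qed.

Lemma invmx_dimx_rec n (D : digraph n) (i j : 'I_n) :
  invmx (dimx D) i j =
    (i == j)%:R - \sum_(k | k != i) dimx D i k * invmx (dimx D) k j.
Proof.
have /matrixP/(_ i j) := mulmxV (dimx_unitmx D).
rewrite [LHS]mxE [RHS]mxE (bigD1 i) //= {1}mxE eqxx mul1r => <-.
by rewrite addrK.
Qed.

Lemma sum_neq0 (R : nmodType) (I : finType) (P : pred I) (F : I -> R) :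
  \sum_(k | P k) F k != 0 -> exists2 k, P k & F k != 0.
Proof.
move=> nz; have [/exists_inP//|none] := boolP [exists (k | P k), F k != 0].
case/eqP: nz; apply: big1 => k Pk; apply: contraNeq none => nz.
by apply/exists_inP; exists k.
Qed.

Lemma invmx_dimx_dipath n (D : digraph n) (i j : 'I_n) :
  invmx (dimx D) i j != 0 -> exists p : seq (edge D), dipath i p j.
Proof.
(* Edges increase the vertex, so the distance of [i] to [n] decreases. *)
have [m] := ubnP (n - i)%N; elim: m i => // m IHm i le_im nz.
have [->|ne_ij] := eqVneq i j; first by exists [::] => /=.
move: nz; rewrite invmx_dimx_rec (negPf ne_ij) sub0r oppr_eq0.
case/sum_neq0=> k ne_ki; rewrite mulf_eq0 negb_or => /andP[nzB nzC].
have [|e src_e tgt_e] := dimx_neq0_edge _ nzB; first by rewrite eq_sym.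
have lt_ik : (i < k)%N by rewrite -src_e -tgt_e src_lt_tgt.
have [|p pth_p] := IHm k _ nzC.
  rewrite -ltnS; apply: leq_trans le_im; rewrite ltnS.
  exact: ltn_sub2l (ltn_ord i) lt_ik.
by exists (e :: p); rewrite /= src_e eqxx tgt_e.
Qed.

(** A nonzero off-diagonal term of the recursion would close a directed cycle
    through [i]. *)
Lemma invmx_dimx_diag n (D : digraph n) (i : 'I_n) : invmx (dimx D) i i = 1.
Proof.
rewrite invmx_dimx_rec eqxx big1 ?subr0 // => k ne_ki.
apply/eqP; apply: contraT; rewrite mulf_eq0 negb_or.
case/andP=> nzB /invmx_dimx_dipath[p /dipath_leq le_ki].
have [|e src_e tgt_e] := dimx_neq0_edge _ nzB; first by rewrite eq_sym.
by have := src_lt_tgt e; rewrite src_e tgt_e ltnNge le_ki.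
Qed.

(** In the recursion for [C u v] a term with intermediate vertex [k != v] would
    yield an edge [u -> k] followed by a nonempty path from [k] to [v]; only
    the term of [k = v] survives. *)
Lemma invmx_dimx_short n (D : digraph n) (u v : 'I_n) :
    u != v ->
    (forall q : seq (edge D), dipath u q v -> (size q <= 1)%N) ->
  invmx (dimx D) u v = - dimx D u v.
Proof.
move=> ne_uv short; rewrite invmx_dimx_rec (negPf ne_uv) sub0r.
rewrite (bigD1 v) 1?eq_sym //= invmx_dimx_diag mulr1 big1 ?addr0 // => k.
case/andP=> ne_ku ne_kv; apply/eqP; apply: contraT; rewrite mulf_eq0 negb_or.
case/andP=> nzB /invmx_dimx_dipath[p pth_p].
have [|e src_e tgt_e] := dimx_neq0_edge _ nzB; first by rewrite eq_sym.
have := short (e :: p); rewrite /= src_e eqxx tgt_e => /(_ pth_p).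
by case: p pth_p => //= /eqP eq_kv; rewrite eq_kv eqxx in ne_kv.
Qed.

Lemma dimx_edge_gt0 n (D : digraph n) (e : edge D) :
  0 < dimx D (src e) (tgt e).
Proof.
rewrite mxE -val_eqE (ltn_eqF (src_lt_tgt e)) ltz_nat.
by apply/card_gt0P; exists e; rewrite inE !eqxx.
Qed.

Lemma mulmx_diag2 (R : comNzRingType) n (S A : 'M[R]_n) i j :
  is_diag_mx S -> (S *m A *m S) i j = S i i * A i j * S j j.
Proof.
by case/diag_mxP=> d ->; rewrite mul_mx_diag mul_diag_mx !mxE !eqxx !mulr1n.
Qed.

Theorem theorem3p3 (n : nat) (D : digraph n) :
  signable (invmx (dimx D)) -> bipartite_subgraph (@maxpath_subgraph n D).
Proof.
case=> S [diagS signS eqS]; exists [set i | S i i == 1].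
have sep (e : edge D) : maxpath_subgraph e ->
    (S (src e) (src e) == 1) != (S (tgt e) (tgt e) == 1).
  move=> max_e; have ne_e : src e != tgt e.
    by rewrite -val_eqE (ltn_eqF (src_lt_tgt e)).
  have := mulmx_diag2 (invmx (dimx D)) (src e) (tgt e) diagS.
  rewrite eqS mxE (invmx_dimx_short ne_e); last first.
    by move=> q; exact: maxpath_edge_longest.
  have gt0 := dimx_edge_gt0 e; rewrite normrN gtr0_norm //.
  (* Equal signs would make a positive number equal to its opposite. *)
  have neq : dimx D (src e) (tgt e) != - dimx D (src e) (tgt e).
    by rewrite gt_eqF // (lt_trans _ gt0) // oppr_lt0.
  case: (signS (src e)) (signS (tgt e)) => -> [] -> //.
    by rewrite mul1r mulr1 => /eqP; rewrite (negPf neq).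
  by rewrite mulN1r mulrN1 opprK => /eqP; rewrite (negPf neq).
by move=> u v [e /sep sep_e [[<- <-]|[<- <-]]]; rewrite !inE // eq_sym.
Qed.
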